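(* Let $X \in \mathbb{R}^{n\times p}$, $\lambda > 0$ and let $\mathrm{pen}:\mathbb{R}^p\to\mathbb{R}$ be a polyhedral gauge. Assume that uniform uniqueness holds, i.e. for every $y \in \mathbb{R}^n$ the set $S_{X,\lambda\mathrm{pen}}(y)$ consists of a unique minimizer $\hat\beta(y)$. Let $\beta \in \mathbb{R}^p$. If the pattern of $\beta$ is accessible with respect to $X$ and $\mathrm{pen}$, then the set $A_\beta = \{y \in \mathbb{R}^n : \hat\beta(y) \overset{\mathrm{pen}}{\sim} \beta\}$ has non-empty interior.
   Context: A prime denotes transpose. A (real-valued) polyhedral gauge on $\mathbb{R}^p$ is a function of the form $\mathrm{pen}(b) = \max\{u_1'b,\dots,u_k'b\}$ for some $u_1,\dots,u_k \in \mathbb{R}^p$ with $u_1 = 0$; $\partial_{\mathrm{pen}}(\beta)$ is its subdifferential at $\beta$. For $y\in\mathbb{R}^n$ and $\lambda>0$ let $S_{X,\lambda\mathrm{pen}}(y) = \mathrm{Arg}\min_{b\in\mathbb{R}^p} \frac12\|y-Xb\|_2^2 + \lambda\,\mathrm{pen}(b)$. Write $b \overset{\mathrm{pen}}{\sim} \beta$ if $\partial_{\mathrm{pen}}(b) = \partial_{\mathrm{pen}}(\beta)$. The pattern of $\beta$ is accessible with respect to $X$ and $\lambda\,\mathrm{pen}$ if there exist $y\in\mathbb{R}^n$ and $\hat\beta \in S_{X,\lambda\mathrm{pen}}(y)$ with $\hat\beta \overset{\mathrm{pen}}{\sim}\beta$; this does not depend on the value of $\lambda>0$, so one says ''accessible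 with respect to $X$ and $\mathrm{pen}$''. *)

(* Defs.v *)
From HB Require Import structures.
From mathcomp Require Import all_boot all_order all_algebra.
From mathcomp Require Import all_classical all_reals all_analysis.

Set Implicit Arguments.
Unset Strict Implicit.
Unset Printing Implicit Defensive.

Import Order.TTheory GRing.Theory Num.Theory.
Import numFieldNormedType.Exports.

Local Open Scope classical_set_scope.
Local Open Scope ring_scope.

Section Definitions.
Variable R : realType.

Definition dot (p : nat) (u v : 'cV[R]_p) : R := (u^T *m v) 0 0.

(* The Euclidean norm; the library's norm on matrices is the sup norm. *)
Definition norm2 (p : nat) (v : 'cV[R]_p) : R :=
  Num.sqrt (\sum_(i < p) v i 0 ^+ 2).

(* The family is indexed by 'I_k.+1, so it is nonempty; taking its first term
   as the default value of the big operator makes this the exact maximum. *)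
Definition polyhedral_gauge (p : nat) (pen : 'cV[R]_p -> R) : Prop :=
  exists (k : nat) (u : 'I_k.+1 -> 'cV[R]_p),
    u ord0 = 0 /\
    forall b, pen b = \big[Num.max/dot (u ord0) b]_(i < k.+1) dot (u i) b.

Definition subdiff (p : nat) (f : 'cV[R]_p -> R) (b : 'cV[R]_p) :
    set 'cV[R]_p :=
  [set s | forall z, f b + dot s (z - b) <= f z].

Definition same_pattern (p : nat) (pen : 'cV[R]_p -> R) (b beta : 'cV[R]_p) :
    Prop :=
  subdiff pen b = subdiff pen beta.

Definition objective (n p : nat) (X : 'M[R]_(n, p)) (lam : R)
    (pen : 'cV[R]_p -> R) (y : 'cV[R]_n) (b : 'cV[R]_p) : R :=
  2^-1 * norm2 (y - X *m b) ^+ 2 + lam * pen b.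

Definition solutions (n p : nat) (X : 'M[R]_(n, p)) (lam : R)
    (pen : 'cV[R]_p -> R) (y : 'cV[R]_n) : set 'cV[R]_p :=
  [set b | forall c, objective X lam pen y b <= objective X lam pen y c].

Definition accessible (n p : nat) (X : 'M[R]_(n, p)) (lam : R)
    (pen : 'cV[R]_p -> R) (beta : 'cV[R]_p) : Prop :=
  exists (y : 'cV[R]_n) (b : 'cV[R]_p),
    solutions X lam pen y b /\ same_pattern pen b beta.

End Definitions.

(* Main.v *)
Require Import Defs.
From HB Require Import structures.
From mathcomp Require Import all_boot all_order all_algebra.
From mathcomp Require Import all_classical all_reals all_analysis.
From mathcomp Require Import lra.

Import Order.TTheory GRing.Theory Num.Theory.
Import numFieldNormedType.Exports.

Local Open Scope classical_set_scope.
Local Open Scope ring_scope.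

(** Write [pen b = max_i <u_i, b>] and call [i] active at [b] when [u_i]
    attains this maximum. Two points with the same active indices have the same
    subdifferential ([subdiff_eq]), so it suffices to find an open set of
    observations [y] whose solution has the active set [S] of one accessible
    solution [b].

    Uniqueness at the observation that yields [b] has a dual meaning. If
    [X h = 0] and [<u_i, h> <= 0] for every [i] in [S], then a short step from
    [b] along [h] keeps the fit and does not increase the penalty; it is a
    solution too, hence [h = 0] ([unique_solution_descent]). By Stiemke's
    alternative ([stiemke_rowspace]) some convex combination [ubar] of the
    active [u_i], with all weights positive, lies in the row space of [X], say
    [ubar = X^T z0]: the row space meets the relative interior of the face
    [conv {u_i | i in S}] of the polytope [conv {u_i}].

    The interior point is [y1 = X b + lam z0], for which [b] satisfies the
    optimality condition with the subgradient [ubar]. Let [L] be the space of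
    directions along which all active forms agree. A perturbation [d] of [y1]
    splits orthogonally into a part [X l] with [l] in [L] and a part [r]
    orthogonal to [X L] ([kernel_split]). The first part moves the solution to
    [b + l]. As [X^T r] is orthogonal to [L], it is a combination of the vectors
    [u_i - ubar], [i] in [S], so the second part only changes the weights of the
    subgradient. Both changes are linear in [d]: for small [d] the weights stay
    nonnegative and the inactive forms stay below the maximum, hence [b + l] is
    the solution at [y1 + d], with the active set [S]. *)

Set Implicit Arguments.
Unset Strict Implicit.

(** * The dot product *)

Section DotProduct.
Context {R : realType}.

Lemma dotE p (u v : 'cV[R]_p) : dot u v = \sum_(i < p) u i 0 * v i 0.
Proof. by rewrite /dot mxE; apply: eq_bigr => i _; rewrite mxE. Qed.

Lemma dotC p (u v : 'cV[R]_p) : dot u v = dot v u.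
Proof. by rewrite !dotE; apply: eq_bigr => i _; rewrite mulrC. Qed.

Lemma dotDr p (u v w : 'cV[R]_p) : dot u (v + w) = dot u v + dot u w.
Proof. by rewrite /dot mulmxDr mxE. Qed.

Lemma dotNr p (u v : 'cV[R]_p) : dot u (- v) = - dot u v.
Proof. by rewrite /dot mulmxN mxE. Qed.

Lemma dotBr p (u v w : 'cV[R]_p) : dot u (v - w) = dot u v - dot u w.
Proof. by rewrite dotDr dotNr. Qed.

Lemma dotZr p a (u v : 'cV[R]_p) : dot u (a *: v) = a * dot u v.
Proof. by rewrite /dot -scalemxAr mxE. Qed.

Lemma dot0r p (u : 'cV[R]_p) : dot u 0 = 0.
Proof. by rewrite /dot mulmx0 mxE. Qed.

Lemma dot0l p (u : 'cV[R]_p) : dot 0 u = 0.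
Proof. by rewrite dotC dot0r. Qed.

Lemma dotDl p (u v w : 'cV[R]_p) : dot (u + v) w = dot u w + dot v w.
Proof. by rewrite !(dotC _ w) dotDr. Qed.

Lemma dotBl p (u v w : 'cV[R]_p) : dot (u - v) w = dot u w - dot v w.
Proof. by rewrite !(dotC _ w) dotBr. Qed.

Lemma dotZl p a (u v : 'cV[R]_p) : dot (a *: u) v = a * dot u v.
Proof. by rewrite !(dotC _ v) dotZr. Qed.

Lemma dot_suml p (I : finType) (P : pred I) (f : I -> 'cV[R]_p) v :
  dot (\sum_(i | P i) f i) v = \sum_(i | P i) dot (f i) v.
Proof.
elim/big_rec2: _ => [|i a b _ <-]; first exact: dot0l.
by rewrite dotDl.
Qed.

Lemma dot_mull n p (A : 'M[R]_(n, p)) u v : dot (A^T *m u) v = dot u (A *m v).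
Proof. by rewrite /dot trmx_mul trmxK mulmxA. Qed.

Lemma dot_ge0 p (u : 'cV[R]_p) : 0 <= dot u u.
Proof. by rewrite dotE; apply: sumr_ge0 => i _; rewrite -expr2 sqr_ge0. Qed.

Lemma dot_eq0 p (u : 'cV[R]_p) : dot u u = 0 -> u = 0.
Proof.
rewrite dotE => /eqP; rewrite psumr_eq0 => [/allP u0|i _]; last first.
  by rewrite -expr2 sqr_ge0.
apply/colP => i; rewrite mxE; apply/eqP.
by have /u0 := mem_index_enum i; rewrite /= mulf_eq0 orbb.
Qed.

Lemma norm2_sqr p (u : 'cV[R]_p) : norm2 u ^+ 2 = dot u u.
Proof.
rewrite sqr_sqrtr; first by rewrite dotE; apply: eq_bigr => i _; rewrite expr2.
by apply: sumr_ge0 => i _; rewrite sqr_ge0.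
Qed.

Lemma mulmx_tr_eq0 n p (A : 'M[R]_(n, p)) : A^T *m A = 0 -> A = 0.
Proof.
move=> A0; apply/matrixP => i j; rewrite mxE.
have /dot_eq0/colP/(_ i) : dot (col j A) (col j A) = 0.
  have /matrixP/(_ j j) := A0.
  rewrite [RHS]mxE => A0j; rewrite -[RHS]A0j dotE [RHS]mxE.
  by apply: eq_bigr => l _; rewrite !mxE.
by rewrite !mxE.
Qed.

Lemma mulmx_tr_sum m p (A : 'M[R]_(m, p)) (q : 'cV[R]_m) :
  A^T *m q = \sum_i q i 0 *: (row i A)^T.
Proof.
apply/colP => j; rewrite mxE summxE; apply: eq_bigr => i _.
by rewrite !mxE mulrC.
Qed.

Lemma near_dot_lt p (e y : 'cV[R]_p) (c : R) : 0 < c ->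
  \forall z \near y, dot e (z - y) < c.
Proof.
move=> c0.
have ce : continuous (fun z : 'cV[R]_p => dot e z).
  under eq_fun do rewrite dotE.
  apply: continuous_big => [|i _]; first exact: add_continuous.
  move=> z; apply: cvgMl_tmp; first exact: nbhs_filter.
  exact: coord_continuous.
have ez : dot e y < dot e y + c by rewrite ltrDl.
have yF : Filter (nbhs y) := nbhs_filter y.
have := @cvgr_lt _ _ _ yF _ _ (ce y) _ ez.
by apply: filterS => z; rewrite dotBr ltrBlDl.
Qed.

End DotProduct.

(** * Farkas' lemma and Stiemke's alternative *)

Section Farkas.
Context {R : realType}.

(** Induction on the number of generators. If [c] is not in the cone of all but
    the first generator, some [h] separates it from them. When [h] fails only
    because [a_0] is on the wrong side, project along [a_0] onto the
    orthogonal of [h] and apply the induction hypothesis to the projections: a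
    conic representation of the projection of [c] lifts to one of [c], the
    coefficient of [a_0] being nonnegative by the choice of [h]. *)
Lemma farkas p m (a : 'I_m -> 'cV[R]_p) (c : 'cV[R]_p) :
  (forall h, (forall i, dot (a i) h <= 0) -> dot c h <= 0) ->
  exists2 w : 'I_m -> R, forall i, 0 <= w i & c = \sum_i w i *: a i.
Proof.
elim: m a c => [|m IH] a c polar.
  exists (fun=> 0) => //; rewrite big_ord0; apply: dot_eq0.
  by apply/eqP; rewrite eq_le dot_ge0 andbT; apply: polar => -[].
have [|] := pselect (forall h, (forall i, dot (a (lift ord0 i)) h <= 0) ->
    dot c h <= 0).
  move=> /IH[w w0 cE].
  exists (fun i => if unlift ord0 i is Some j then w j else 0).
    by move=> i; case: unliftP.
  rewrite big_ord_recl unlift_none scale0r add0r {1}cE.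
  by apply: eq_bigr => i _; rewrite liftK.
move=> /existsNP[h /not_implyP[ah /negP]]; rewrite -ltNge => ch.
have a0h : 0 < dot (a ord0) h.
  rewrite ltNge; apply/negP => a0h; suff: dot c h <= 0 by rewrite leNgt ch.
  by apply: polar => i; case: (unliftP ord0 i) => [j|] ->.
have a0h0 := lt0r_neq0 a0h.
pose proj (v : 'cV[R]_p) := v - (dot v h / dot (a ord0) h) *: a ord0.
have [|w w0 pcE] := IH (fun i => proj (a (lift ord0 i))) (proj c).
  move=> g ag.
  (* the adjoint of proj, applied to g: it is orthogonal to a ord0 *)
  pose g' := g - (dot (a ord0) g / dot (a ord0) h) *: h.
  have projg v : dot v g' = dot (proj v) g.
    rewrite /g' /proj dotBr dotZr dotBl dotZl; congr (_ - _).
    by rewrite [LHS]mulrAC [RHS]mulrAC (mulrC (dot v h)).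
  rewrite -projg; apply: polar => i; case: (unliftP ord0 i) => [j|] ->.
    by rewrite projg.
  by rewrite dotBr dotZr divfK // subrr.
exists (fun i => if unlift ord0 i is Some j then w j else
    (dot c h - \sum_j w j * dot (a (lift ord0 j)) h) / dot (a ord0) h).
  move=> i; case: unliftP => //= _; apply: divr_ge0; last exact: ltW.
  rewrite subr_ge0; apply: le_trans (ltW ch).
  by apply: sumr_le0 => j _; apply: mulr_ge0_le0.
rewrite big_ord_recl unlift_none.
under [X in _ = _ + X]eq_bigr do rewrite liftK.
have -> : c = proj c + (dot c h / dot (a ord0) h) *: a ord0 by rewrite subrK.
rewrite {1}pcE.
have -> : \sum_i w i *: proj (a (lift ord0 i)) = \sum_i w i *: a (lift ord0 i)
  - ((\sum_j w j * dot (a (lift ord0 j)) h) / dot (a ord0) h) *: a ord0.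
  rewrite mulr_suml scaler_suml -sumrB; apply: eq_bigr => i _.
  by rewrite /proj scalerBr scalerA mulrA.
by rewrite subrK mulrBl scalerBl addrAC -addrA addrC.
Qed.

(** Each [- a_i] lies in the cone of the family by [farkas], which gives a
    vanishing nonnegative combination where [a_i] has weight at least 1; adding
    these over [i] makes all weights positive. *)
Lemma stiemke p m (a : 'I_m -> 'cV[R]_p) :
  (forall h, (forall i, dot (a i) h <= 0) -> forall i, dot (a i) h = 0) ->
  exists2 w : 'I_m -> R, forall i, 0 < w i & \sum_i w i *: a i = 0.
Proof.
move=> nodesc.
have neg i : exists W : 'I_m -> R,
    (forall j, 0 <= W j) /\ - a i = \sum_j W j *: a j.
  have [h ah|W W0 WE] := @farkas _ _ a (- a i); last by exists W.
  by rewrite dotC dotNr dotC nodesc // oppr0.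
have /choice[W /all_and2[W0 WE]] := neg.
exists (fun j => 1 + \sum_i W i j) => [j|].
  by apply: ltr_pwDl => //; apply: sumr_ge0.
under eq_bigr do rewrite scalerDl scale1r scaler_suml.
rewrite big_split exchange_big /=.
under [X in _ + X]eq_bigr do rewrite -WE.
by rewrite sumrN subrr.
Qed.

(** This is [stiemke] for the restrictions of the linear forms [u_i] to the
    kernel of [X], in the coordinates given by the columns of [cokermx X]. A
    form that vanishes on the kernel of [X] belongs to its row space. *)
Lemma stiemke_rowspace n p m (X : 'M[R]_(n, p)) (u : 'I_m -> 'cV[R]_p)
    (S : pred 'I_m) :
  (exists i, S i) ->
  (forall h, X *m h = 0 -> (forall i, S i -> dot (u i) h <= 0) -> h = 0) ->
  exists w : 'I_m -> R, exists z : 'cV[R]_n,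
    [/\ forall i, S i -> 0 < w i, \sum_(i | S i) w i = 1
      & \sum_(i | S i) w i *: u i = X^T *m z].
Proof.
move=> [i0 Si0] nodesc; pose N := cokermx X.
(* the indices outside S get a zero vector, whose weight is then dropped *)
pose a i := if S i then N^T *m u i else 0.
have [h ah i|w w0 wE] := @stiemke _ _ a.
  rewrite /a; case: ifP => Si; last exact: dot0l.
  rewrite dot_mull (_ : N *m h = 0) ?dot0r //; apply: nodesc => [|j Sj].
    by rewrite mulmxA mulmx_coker mul0mx.
  by have := ah j; rewrite /a Sj dot_mull.
pose t := \sum_(i | S i) w i.
have t0 : 0 < t.
  by rewrite /t (bigD1 i0) //=; apply: ltr_pwDl => //; apply: sumr_ge0 => i _;
    apply: ltW.
have NU : N^T *m (\sum_(i | S i) (w i / t) *: u i) = 0.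
  transitivity (t^-1 *: \sum_i w i *: a i); last by rewrite wE scaler0.
  rewrite mulmx_sumr scaler_sumr [LHS]big_mkcond.
  apply: eq_bigr => i _; rewrite /a; case: ifP => Si; last by rewrite !scaler0.
  by rewrite -scalemxAr scalerA mulrC.
have : ((\sum_(i | S i) (w i / t) *: u i)^T <= X)%MS.
  by rewrite submxE -[X in X == _]trmxK trmx_mul trmxK NU trmx0.
move=> /submxP[z zE]; exists (fun i => w i / t), z^T; split.
- by move=> i _; apply: divr_gt0.
- by rewrite -mulr_suml divff // lt0r_neq0.
- by rewrite -trmx_mul -zE trmxK.
Qed.

End Farkas.

(** * Least-squares splitting of an observation *)

Section Splitting.
Context {R : realType}.

(** [M A] is the orthogonal projection onto the column space of [M]. It exists
    because [M^T M] has the same kernel, hence the same row space, as [M]. *)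
Lemma normal_equations n p (M : 'M[R]_(n, p)) :
  exists A : 'M[R]_(p, n), M^T *m (1%:M - M *m A) = 0.
Proof.
have /submxP[B BE] : (M <= M^T *m M)%MS.
  rewrite submxE; apply/eqP/mulmx_tr_eq0.
  by rewrite trmx_mul -mulmxA (mulmxA M^T) mulmx_coker mulmx0.
exists B^T; rewrite mulmxBr mulmx1.
by rewrite {1}BE !trmx_mul trmxK mulmxA subrr.
Qed.

(** With [L] the kernel of [D], [X H] is the orthogonal projection onto [X L] and
    [H] takes its values in [L]. What the projection leaves, once multiplied by
    [X^T], is orthogonal to [L], that is, in the span of the rows of [D]; [Q]
    gives its coordinates. Matrices rather than a pointwise statement make the
    splitting linear in the observation. *)
Lemma kernel_split n p m (X : 'M[R]_(n, p)) (D : 'M[R]_(m, p)) :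
  exists (H : 'M[R]_(p, n)) (Q : 'M[R]_(m, n)),
    D *m H = 0 /\ X^T *m (1%:M - X *m H) = D^T *m Q.
Proof.
have [A AE] := normal_equations (X *m cokermx D).
pose H := cokermx D *m A.
have : ((X^T *m (1%:M - X *m H))^T <= D)%MS.
  rewrite submxE -[X in X == _]trmxK trmx_mul trmxK.
  by rewrite mulmxA -trmx_mul /H (mulmxA X (cokermx D)) AE trmx0.
move=> /submxP[Q QE]; exists H, Q^T; split.
  by rewrite mulmxA mulmx_coker mul0mx.
by rewrite -trmx_mul -QE trmxK.
Qed.

End Splitting.

(** * Maxima of finitely many linear forms *)

Section MaxOfLinearForms.
Context {R : realType}.

(** The common form of the arguments by a short step: an inactive form has some
    slack and survives any small move, so that only the slopes of the active
    ones matter. *)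
Lemma small_step m (a b : 'I_m -> R) :
  (forall i, a i <= 0) -> (forall i, a i = 0 -> b i <= 0) ->
  exists2 t, 0 < t & forall i, a i + t * b i <= 0.
Proof.
move=> a0 b0; pose s := 1 + \sum_i `|b i / a i|.
(* s bounds all ratios `|b i / a i|, hence t = s^-1 gives t * `|b i| <= `|a i|
   whenever a i != 0 *)
have s0 : 0 < s by apply: ltr_pwDl => //; apply: sumr_ge0.
exists s^-1 => [|i]; first by rewrite invr_gt0.
have [ai0|ai0] := eqVneq (a i) 0.
  by rewrite ai0 add0r; apply: mulr_ge0_le0; [rewrite invr_ge0 ltW|exact: b0].
have ai : a i < 0 by rewrite lt_neqAle ai0 a0.
have : `|b i| <= s * `|a i|.
  rewrite -ler_pdivrMr ?normr_gt0 // -normf_div /s (bigD1 i) //= addrCA lerDl.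
  by apply: addr_ge0 => //; apply: sumr_ge0.
rewrite (ltr0_norm ai) => /(le_trans (ler_norm _)).
rewrite -(@ler_pM2l _ s^-1) ?invr_gt0 // mulrA mulVf ?lt0r_neq0 // mul1r.
lra.
Qed.

Variables (p k : nat) (u : 'I_k -> 'cV[R]_p) (pen : 'cV[R]_p -> R).
Hypothesis pen_ub : forall i b, dot (u i) b <= pen b.
Hypothesis pen_att : forall b, exists i, dot (u i) b = pen b.

Lemma pen_le b x : (forall i, dot (u i) b <= x) -> pen b <= x.
Proof. by have [i <-] := pen_att b; apply. Qed.

(** Go from [b] slightly away from [c]. The indices active at [b] are also active
    at [c], so that the penalty is at most its affine extrapolation from [c]
    through [b]; the subgradient inequality of [s] at that point yields
    [<s, c - b> >= pen c - pen b], which turns a subgradient at [b] into one at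
    [c]. *)
Lemma subdiff_sub b c :
  (forall i, dot (u i) b = pen b -> dot (u i) c = pen c) ->
  subdiff pen b `<=` subdiff pen c.
Proof.
move=> bc s sb z.
have [||t t0 ht] := @small_step _ (fun i => dot (u i) b - pen b)
    (fun i => dot (u i) (b - c) - (pen b - pen c)).
- by move=> i; rewrite subr_le0.
- by move=> i /eqP; rewrite subr_eq0 => /eqP ib; rewrite dotBr ib bc // subrr.
have : pen (b + t *: (b - c)) <= pen b + t * (pen b - pen c).
  by apply: pen_le => i; have := ht i; rewrite (dotDr _ b (t *: _)) dotZr; lra.
have := sb (b + t *: (b - c)).
rewrite (addrAC b) subrr add0r dotZr => /le_trans h /h.
rewrite lerD2l ler_pM2l // => sbc.
have := sb z; move: sbc; rewrite !dotBr; lra.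
Qed.

Lemma subdiff_eq b c :
  (forall i, dot (u i) b = pen b <-> dot (u i) c = pen c) ->
  subdiff pen b = subdiff pen c.
Proof. by move=> bc; apply/seteqP; split; apply: subdiff_sub => i /bc. Qed.

Lemma convex_subdiff b (S : pred 'I_k) (w : 'I_k -> R) :
  (forall i, S i -> dot (u i) b = pen b) ->
  (forall i, S i -> 0 <= w i) -> \sum_(i | S i) w i = 1 ->
  subdiff pen b (\sum_(i | S i) w i *: u i).
Proof.
move=> Sb w0 w1 z; rewrite dot_suml -[pen b]mul1r -[leRHS]mul1r -w1 !mulr_suml.
rewrite -big_split; apply: ler_sum => i Si /=.
by rewrite dotZl dotBr Sb // -mulrDr addrC subrK ler_wpM2l // w0.
Qed.

End MaxOfLinearForms.

(** * Solutions of the penalized problem *)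

Section LeastSquares.
Context {R : realType}.
Variables (n p : nat) (X : 'M[R]_(n, p)) (lam : R) (pen : 'cV[R]_p -> R).
Hypothesis lam0 : 0 < lam.

(** Expanding the square around [b], the linear term is [- lam <s, c - b>], which
    the subgradient inequality compensates. *)
Lemma subgradient_solution y b s :
  subdiff pen b s -> X^T *m (y - X *m b) = lam *: s -> solutions X lam pen y b.
Proof.
move=> sb opt c; rewrite /objective !norm2_sqr.
have -> : y - X *m c = (y - X *m b) - X *m (c - b).
  by rewrite mulmxBr opprB addrA addrNK.
set r := y - X *m b.
have : dot r (X *m (c - b)) = lam * dot s (c - b).
  by rewrite -dot_mull opt dotZl.
move: (dot_ge0 (X *m (c - b))) (sb c); set v := X *m _ => vv.
rewrite -(ler_pM2l lam0) mulrDr => sbc rv.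
by rewrite (dotBr _ r) !(dotBl r) (dotC v r) rv; lra.
Qed.

(** A short step along [h] leaves the fit unchanged and does not increase the
    penalty, so it reaches another solution unless [h = 0]. *)
Lemma unique_solution_descent k (u : 'I_k -> 'cV[R]_p) y b h :
  (forall i b, dot (u i) b <= pen b) ->
  (forall b, exists i, dot (u i) b = pen b) ->
  solutions X lam pen y = [set b] -> X *m h = 0 ->
  (forall i, dot (u i) b = pen b -> dot (u i) h <= 0) -> h = 0.
Proof.
move=> ub att sol Xh desc.
have [||t t0 ht] := @small_step _ _ (fun i => dot (u i) b - pen b)
    (fun i => dot (u i) h).
- by move=> i; rewrite subr_le0.
- by move=> i /eqP; rewrite subr_eq0 => /eqP; apply: desc.
have : solutions X lam pen y (b + t *: h).
  have solb : solutions X lam pen y b by rewrite sol.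
  move=> c; apply: le_trans (solb c); rewrite /objective.
  rewrite mulmxDr -scalemxAr Xh scaler0 addr0 lerD2l ler_pM2l //.
  apply: (pen_le att) => i; have := ht i.
  by rewrite dotDr dotZr; lra.
rewrite sol => /eqP; rewrite -[X in _ == X]addr0 (inj_eq (addrI b)).
by rewrite scaler_eq0 gt_eqF // => /eqP.
Qed.

End LeastSquares.

(** * Accessible patterns *)

Lemma polyhedral_gauge_max (R : realType) p (pen : 'cV[R]_p -> R) :
  polyhedral_gauge pen -> exists k (u : 'I_k -> 'cV[R]_p),
    (forall i b, dot (u i) b <= pen b) /\
    (forall b, exists i, dot (u i) b = pen b).
Proof.
move=> [k [u [_ penE]]]; exists k.+1, u; split=> [i|] b; rewrite penE.
  exact: (le_bigmax _ (fun j => dot (u j) b)).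
elim/big_ind: _ => [|x y [i <-] [j <-]|i _]; [by exists ord0| |by exists i].
by rewrite /Num.max; case: ifP => _; [exists j|exists i].
Qed.

Theorem proposition4p3 (R : realType) (n p : nat) (X : 'M[R]_(n, p)) (lam : R)
    (pen : 'cV[R]_p -> R) (betahat : 'cV[R]_n -> 'cV[R]_p) (beta : 'cV[R]_p) :
  0 < lam ->
  polyhedral_gauge pen ->
  (forall y : 'cV[R]_n, solutions X lam pen y = [set betahat y]) ->
  accessible X lam pen beta ->
  ([set y : 'cV[R]_n | same_pattern pen (betahat y) beta])° !=set0.
Proof.
move=> lam0 /polyhedral_gauge_max[k [u [ub att]]] uniq [y0 [b [solb patb]]].
pose S i := dot (u i) b == pen b.
have solb1 : solutions X lam pen y0 = [set b].
  by have := solb; rewrite uniq => ->.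
have [||w [z0 [w0 w1 wE]]] := @stiemke_rowspace _ _ _ _ X u S.
- by have [i /eqP] := att b; exists i.
- move=> h Xh desc; apply: (unique_solution_descent lam0 ub att solb1 Xh).
  by move=> i /eqP; apply: desc.
pose ubar := \sum_(i | S i) w i *: u i.
(* the kernel of D is the space of directions on which the active forms agree;
   centering them at ubar treats them symmetrically *)
pose D := \matrix_(i < k) (if S i then (u i - ubar)^T else 0).
have [H [Q [DH XQ]]] := kernel_split X D.
pose y1 := X *m b + lam *: z0.
exists y1.
pose q (d : 'cV[R]_n) := lam^-1 *: (Q *m d).
(* the weights of ubar + \sum_i q_i (u i - ubar) on the active u i *)
pose w' d i := w i * (1 - \sum_(j | S j) q d j 0) + q d i 0.
have DHd i d : S i -> dot (u i) (H *m d) = dot ubar (H *m d).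
  move=> Si; apply/eqP; rewrite -subr_eq0 -dotBl /dot.
  have -> : (u i - ubar)^T = row i D by rewrite rowK Si.
  by rewrite -row_mul mulmxA DH mul0mx !mxE.
have y1F : Filter (nbhs y1) := nbhs_filter y1.
have near_weights : \forall y \near y1, forall i, S i -> 0 <= w' (y - y1) i.
  apply: (@filter_forall _ _ _ _ y1F) => i.
  case: (boolP (S i)) => Si; last exact: nearW.
  (* the weight of i is w i minus the linear form f evaluated at q *)
  pose f := \col_j (if S j then w i - (j == i)%:R else 0).
  have := near_dot_lt (lam^-1 *: (Q^T *m f)) y1 (w0 i Si).
  apply: filterS => y; rewrite dotZl dot_mull -dotZr -/(q _) => fq _.
  suff fqE : dot f (q (y - y1)) =
      w i * (\sum_(j | S j) q (y - y1) j 0) - q (y - y1) i 0.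
    by rewrite /w'; move: fq; rewrite fqE; lra.
  rewrite dotE mulr_sumr (bigD1 i) // [in RHS](bigD1 i) //= mxE Si eqxx mulrBl.
  rewrite mul1r addrAC; congr (_ + _ - _).
  rewrite [RHS]big_mkcondl; apply: eq_bigr => j /negPf ji.
  by rewrite mxE ji subr0; case: (S j); rewrite ?mul0r.
have near_inactive : \forall y \near y1, forall i, ~~ S i ->
    dot (u i - ubar) (H *m (y - y1)) < pen b - dot (u i) b.
  apply: (@filter_forall _ _ _ _ y1F) => i.
  case: (boolP (S i)) => Si; first exact: nearW.
  have ib : 0 < pen b - dot (u i) b by rewrite subr_gt0 lt_neqAle Si ub.
  have := near_dot_lt (H^T *m (u i - ubar)) y1 ib.
  by apply: filterS => y; rewrite dot_mull.
apply: filterS2 near_weights near_inactive => y wy iy.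
set d := y - y1 in wy iy; pose c := b + H *m d.
have active i : S i -> dot (u i) c = pen b + dot ubar (H *m d).
  by move=> Si; rewrite dotDr DHd // (eqP Si).
have inactive i : ~~ S i -> dot (u i) c < pen b + dot ubar (H *m d).
  by move=> /iy; rewrite dotBl /c dotDr; lra.
have penc : pen c = pen b + dot ubar (H *m d).
  apply/eqP; rewrite eq_le; apply/andP; split.
    apply: (pen_le att) => i; case: (boolP (S i)) => Si.
      by rewrite active.
    exact/ltW/inactive.
  by have [i /eqP Si] := att b; rewrite -(active i Si).
have sub : subdiff pen c (\sum_(i | S i) w' d i *: u i).
  apply: (convex_subdiff ub) => //; first by move=> i Si; rewrite active.
  by rewrite big_split /= -mulr_suml w1 mul1r subrK.
have sol : solutions X lam pen y c.
  apply: (subgradient_solution lam0 sub).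
  have -> : y - X *m c = lam *: z0 + (1%:M - X *m H) *m d.
    rewrite mulmxBl mul1mx -mulmxA /c mulmxDr /d /y1.
    rewrite !opprD !addrA; congr (_ - _).
    by rewrite -(addrA (lam *: z0)) (addrC (lam *: z0)) addrK.
  rewrite mulmxDr -scalemxAr -wE mulmxA XQ -mulmxA mulmx_tr_sum.
  have -> : \sum_i (Q *m d) i 0 *: (row i D)^T =
      lam *: (\sum_(i | S i) q d i 0 *: (u i - ubar)).
    rewrite [in RHS]big_mkcond scaler_sumr; apply: eq_bigr => i _.
    rewrite rowK; case: ifP => Si; last by rewrite trmx0 !scaler0.
    by rewrite trmxK scalerA [q d i 0]mxE mulVKf // lt0r_neq0.
  rewrite -scalerDr; congr (_ *: _).
  under [in RHS]eq_bigr do rewrite scalerDl mulrC -scalerA.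
  rewrite big_split /= -scaler_sumr -/ubar scalerBl scale1r -addrA.
  congr (_ + _).
  under eq_bigr do rewrite scalerBr.
  by rewrite sumrB -scaler_suml addrC.
rewrite /= (_ : betahat y = c); last by move: sol; rewrite uniq => <-.
rewrite /same_pattern -patb; apply: (subdiff_eq ub att) => i.
case: (boolP (S i)) => Si.
  by rewrite active // penc (eqP Si).
split=> [|/eqP iB]; last by rewrite /S iB in Si.
by move=> ic; have := inactive i Si; rewrite -penc ic ltxx.
Qed.
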